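(* Let $n$ be a positive integer, let $p$ be an odd prime with $p\nmid n$, and let $\Phi=T_{4n}\times C_p$. Then the number of cyclic subgroups of $\Phi$ is $$\tau(p)\bigl(\tau(2n)+n\bigr).$$
   Context: $T_{4n}$ denotes the dicyclic group of order $4n$, $T_{4n}=\langle \alpha,\beta \mid \alpha^{2n}=e,\ \alpha^n=\beta^2,\ \beta\alpha\beta^{-1}=\alpha^{-1}\rangle$ (for $n=1$ this is cyclic of order 4). $C_p$ is the cyclic group of order $p$. $\tau(x)$ is the number of positive divisors of $x$. The trivial subgroup is counted as cyclic. *)

(* Defs.v *)
From HB Require Import structures.
From mathcomp Require Import all_boot all_order all_fingroup all_solvable.
Set Implicit Arguments.
Unset Strict Implicit.
Unset Printing Implicit Defensive.

Local Open Scope group_scope.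

(* [Grp] specifies the largest finite quotient of the presented group, up to  *)
(* isomorphism; this is the presented group itself, which is finite (of order *)
(* 4n) as soon as 0 < n.                                                      *)
Definition dicyclic (n : nat) (gT : finGroupType) (T : {group gT}) : Prop :=
  T \isog Grp (a : b : a ^+ (2 * n)%N, a ^+ n = b ^+ 2, b * a * b^-1 = a^-1).

Definition tau (m : nat) : nat := size (divisors m).

Definition cyclic_subgroups (gT : finGroupType) (G : {set gT}) :
    {set {group gT}} :=
  [set H in subgroups G | cyclic H].

(* Main.v *)
(* Since 4n and p are coprime, the cyclic subgroups of T x C are the products *)
(* of cyclic subgroups of T and of C. In T = <x> u <x>y, those contained in   *)
(* the cyclic group <x> of order 2n are counted by tau (2n). Every element g  *)
(* of <x>y has g^2 = x^n, hence order 4, so each of the remaining cyclic      *)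
(* subgroups accounts for totient 4 = 2 of the 2n elements of <x>y, and there *)
(* are n of them. That the presented group has order 4n, and no less, is seen *)
(* from a permutation group satisfying the relations.                         *)
Require Import Defs.
From HB Require Import structures.
From mathcomp Require Import all_boot all_order all_fingroup all_solvable.
From mathcomp Require Import ssralg zmodp.

Set Implicit Arguments.
Unset Strict Implicit.
Unset Printing Implicit Defensive.

Section CyclicSubgroups.

Local Open Scope group_scope.

(** A generator of a cyclic subgroup of T x C has components of coprime orders, so the subgroup is
    the product of its projections and the count is multiplicative
    ([card_cyclic_subgroups_coprime_setX]); C contributes tau p ([card_cyclic_subgroups_cyclic]).
    For T, [dicyclic_structure] exhibits a cyclic subgroup of index 2 whose complement is a coset of
    2n elements, all of order 4 ([order_dicyclic_coset]); [card_cyclic_subgroups_outside] turns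
    these into n further subgroups. *)

Lemma mem_cyclic_subgroups (gT : finGroupType) (A : {set gT}) (H : {group gT}) :
  (H \in cyclic_subgroups A) = (H \subset A) && cyclic H.
Proof. by rewrite !inE. Qed.

Lemma cyclic_subgroupsS (gT : finGroupType) (A B : {set gT}) :
  A \subset B -> cyclic_subgroups A \subset cyclic_subgroups B.
Proof.
move=> sAB; apply/subsetP=> H; rewrite !mem_cyclic_subgroups => /andP[sHA ->].
by rewrite (subset_trans sHA).
Qed.

Variables (gT rT : finGroupType).
Implicit Types (G : {group gT}) (K : {group rT}).

(** A cyclic group has exactly one subgroup of each order dividing its own, so cardinality maps its
    subgroups bijectively onto the divisors. *)
Lemma card_cyclic_subgroups_cyclic G :
  cyclic G -> #|cyclic_subgroups G| = tau #|G|.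
Proof.
move=> cycG.
have injc : {in cyclic_subgroups G &,
    injective (fun H : {group gT} => #|H|)}.
  move=> H1 H2; rewrite !mem_cyclic_subgroups.
  case/andP=> sH1G _ /andP[sH2G _] eqH; apply/val_inj/eqP => /=.
  by rewrite (eq_subG_cyclic cycG) ?eqH.
rewrite cardE -(size_map (fun H : {group gT} => #|H|)).
apply/perm_size/uniq_perm; rewrite ?divisors_uniq //.
  rewrite map_inj_in_uniq ?enum_uniq // => H1 H2.
  by rewrite !mem_enum; apply: injc.
move=> d; rewrite -dvdn_divisors ?cardG_gt0 //.
apply/mapP/idP => [[H] | d_dv].
  by rewrite mem_enum mem_cyclic_subgroups => /andP[sHG _] ->; apply: cardSg.
have [g defG] := cyclicP cycG.
have dv : d %| #[g] by rewrite orderE -defG.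
exists <[g ^+ (#[g] %/ d)]>%G.
  rewrite mem_enum mem_cyclic_subgroups cycle_cyclic.
  by rewrite defG cycle_subG mem_cycle.
rewrite /= -orderE orderXdiv ?dvdn_div //.
by rewrite divnA // mulKn // order_gt0.
Qed.

(** The order of the pair is a multiple of both orders, hence, by coprimality, of their product. *)
Lemma cycle_pair (x : gT) (y : rT) :
  coprime #[x] #[y] -> <[(x, y)]> = setX <[x]> <[y]>.
Proof.
move=> co; apply/eqP; rewrite eqEcard cycle_subG in_setX !cycle_id /=.
rewrite cardsX -!orderE dvdn_leq ?order_gt0 // Gauss_dvd //.
have powX m : (x, y) ^+ m = (x ^+ m, y ^+ m).
  by elim: m => [|m IHm]; rewrite ?expg0 // !expgS IHm.
have:= expg_order (x, y); rewrite powX => -[x1 y1].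
by rewrite !order_dvdn x1 y1 !eqxx.
Qed.

Lemma card_cyclic_subgroups_coprime_setX G K : coprime #|G| #|K| ->
  #|cyclic_subgroups (setX G K)|
    = (#|cyclic_subgroups G| * #|cyclic_subgroups K|)%N.
Proof.
move=> coGK; pose f (AB : {group gT} * {group rT}) := setX_group AB.1 AB.2.
have coxy x y : x \in G -> y \in K -> coprime #[x] #[y].
  move=> Gx Ky; apply: coprime_dvdl (order_dvdG Gx) _.
  exact: coprime_dvdr (order_dvdG Ky) coGK.
have injf : injective f.
  move=> [A B] [A' B'] /(congr1 val)/= /setP eqAB.
  congr (_, _); apply/group_inj/setP => z.
    by have:= eqAB (z, 1); rewrite !in_setX !group1 !andbT.
  by have:= eqAB (1, z); rewrite !in_setX !group1.
rewrite -cardsX -(card_imset _ injf); apply: eq_card => H.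
rewrite mem_cyclic_subgroups; apply/andP/imsetP => [[sH /cyclicP[[x y] defH]]|].
  have: (x, y) \in setX G K by rewrite (subsetP sH) // defH cycle_id.
  rewrite in_setX => /andP[Gx Ky].
  exists (<[x]>%G, <[y]>%G).
    by rewrite in_setX !mem_cyclic_subgroups !cycle_subG Gx Ky !cycle_cyclic.
  by apply/group_inj; rewrite defH /= cycle_pair ?coxy.
case=> -[A B]; rewrite in_setX !mem_cyclic_subgroups /=.
case/andP=> /andP[sAG /cyclicP[x defA]] /andP[sBK /cyclicP[y defB]] ->.
have [Gx Ky] : x \in G /\ y \in K by rewrite -!cycle_subG -defA -defB.
rewrite /= defA defB -cycle_pair ?coxy // cycle_cyclic; split=> //.
by rewrite cycle_subG in_setX Gx.
Qed.

(* Count the elements of G outside X by the cyclic subgroup they generate: a  *)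
(* subgroup of order k is hit totient k times.                                *)
Lemma card_cyclic_subgroups_outside G (X : {group gT}) k : X \subset G ->
    (forall g, g \in G :\: X -> #[g] = k) ->
  #|G :\: X| = (totient k *
     (#|cyclic_subgroups G| - #|cyclic_subgroups X|))%N.
Proof.
move=> sXG oG.
rewrite -(cardsDS (cyclic_subgroupsS sXG)) -sum1_card.
rewrite (partition_big (fun g => <[g]>%G)
  (mem (cyclic_subgroups G :\: cyclic_subgroups X))) /=; last first.
  move=> g /setDP[Gg X'g]; rewrite in_setD !mem_cyclic_subgroups !cycle_subG.
  by rewrite Gg cycle_cyclic (negPf X'g).
rewrite mulnC -sum_nat_const; apply: eq_bigr => H.
rewrite in_setD !mem_cyclic_subgroups => /andP[nXH /andP[sHG cycH]].
have [h defH] := cyclicP cycH; rewrite cycH andbT in nXH.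
have Gh : h \in G :\: X by rewrite inE -!cycle_subG -defH nXH.
(* [H] has [totient k] generators, and each lies outside [X] because [H] is not contained in [X]. *)
rewrite -(oG h Gh) totient_gen sum1_card -cardsE; apply: eq_card => g.
rewrite !inE /generator -defH -val_eqE /= eq_sym; apply: andb_idl => /eqP defHg.
by rewrite in_setD -!cycle_subG; move: nXH sHG; rewrite -defHg /= => ->.
Qed.

End CyclicSubgroups.

Section Dicyclic.

Local Open Scope group_scope.

Definition dicyclic_relations (n : nat) (gT : finGroupType) (a b : gT) : Prop :=
  [/\ a ^+ (2 * n)%N = 1, a ^+ n = b ^+ 2 & b * a * b^-1 = a^-1].

Lemma dicyclic_homP (n : nat) (gT : finGroupType) (H : {group gT}) :
  reflect (exists a b, <[a]> <*> <[b]> = H /\ dicyclic_relations n a b)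
    (H \homg Grp (a : b : a ^+ (2 * n)%N, a ^+ n = b ^+ 2,
                          b * a * b^-1 = a^-1)).
Proof.
apply: (iffP existsP) => [[[a b]] /eqP[] | [a [b [defH [an ab ba]]]]].
  by exists a, b.
by exists (a, b); rewrite /= defH an ab ba !eqxx.
Qed.

(** Moving [y] past [x ^+ i] inverts the latter, so [(x ^+ i * y) ^+ 2 = y ^+ 2 = x ^+ n], which has
    order 2. *)
Lemma order_dicyclic_coset (n : nat) (gT : finGroupType) (x y g : gT) :
    0 < n -> dicyclic_relations n x y -> #[x] = (2 * n)%N ->
  g \in <[x]> :* y -> #[g] = 4.
Proof.
move=> n_gt0 [xn xy yx] ox /rcosetP[_ /cycleP[i ->] ->].
have g2 : (x ^+ i * y) ^+ 2 = x ^+ n.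
  have yxi : y * x ^+ i = x ^- i * y.
    have xVy : x ^ y^-1 = x^-1 by rewrite conjgE invgK mulgA.
    by rewrite -expgVn -xVy -conjXg conjgE invgK mulgA mulgKV.
  by rewrite expgS expg1 mulgA -(mulgA _ y) yxi mulgA mulgV mul1g xy.
have o2 : #[(x ^+ i * y) ^+ 2] = 2.
  by rewrite g2 orderXdiv ox ?dvdn_mull // mulnK.
by rewrite (orderXprime o2).
Qed.

(* (i, s) encodes the normal form alpha ^ i * beta ^ s; dic_rot and dic_flip  *)
(* are the left multiplications by alpha and beta.                            *)
Section Model.

Variable n : nat.
Hypothesis n_gt0 : 0 < n.

Let Z := 'Z_(2 * n).

Import GRing.Theory.
Local Open Scope ring_scope.

Lemma dicyclic_modulus_gt1 : (1 < 2 * n)%N.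
Proof. by rewrite -(prednK n_gt0) mulnS. Qed.

Lemma natr_dicyclic_modulus : (2 * n)%:R = 0 :> Z.
Proof. exact: pchar_Zp dicyclic_modulus_gt1. Qed.

Definition dic_rot (u : Z * bool) : Z * bool := (u.1 + 1, u.2).
Definition dic_flip (u : Z * bool) : Z * bool :=
  (- u.1 + (if u.2 then n%:R else 0), ~~ u.2).

Lemma dic_rot_inj : injective dic_rot.
Proof.
move=> [i s] [j t] eq_uv; have /= eq_ij := congr1 fst eq_uv.
by rewrite (addIr _ eq_ij) (congr1 snd eq_uv : s = t).
Qed.

Lemma dic_flip_inj : injective dic_flip.
Proof.
move=> [i s] [j t] eq_uv; have /= eq_ij := congr1 fst eq_uv.
have eq_st : s = t := negb_inj (congr1 snd eq_uv).
by rewrite eq_st in eq_ij *; rewrite (oppr_inj (addIr _ eq_ij)).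
Qed.

Let a : {perm Z * bool} := perm dic_rot_inj.
Let b : {perm Z * bool} := perm dic_flip_inj.

Lemma dic_rotX k i s : (a ^+ k)%g (i, s) = (i + k%:R, s).
Proof.
elim: k i => [|k IHk] i; first by rewrite expg0 perm1 addr0.
by rewrite expgS permM permE IHk /= -addrA -natr1 [1 + _]addrC.
Qed.

(** Permutations compose left to right, which reverses products of left multiplications; but the
    relations, the last one taken as [a * b * a = b], read the same backwards. *)
Lemma dicyclic_relations_model : dicyclic_relations n a b.
Proof.
have nN : - (n%:R) = n%:R :> Z.
  apply/eqP; rewrite eq_sym -addr_eq0 -natrD addnn -mul2n.
  by rewrite natr_dicyclic_modulus.
have aba : (a * b * a = b)%g.
  by apply/permP=> -[i s]; rewrite !permM !permE /dic_rot /= opprD addrAC subrK.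
split; last by apply: (mulgI a); rewrite mulgV !mulgA aba mulgV.
  by apply/permP=> -[i s]; rewrite dic_rotX natr_dicyclic_modulus addr0 perm1.
apply/permP=> -[i s]; rewrite dic_rotX expgS expg1 permM !permE.
rewrite /dic_flip /= negbK.
by case: s; rewrite /= ?addr0 ?opprD ?opprK ?nN.
Qed.

(** The group is transitive on the 4n normal forms: [(0, false)], which encodes the identity, can be
    sent to any of them. *)
Lemma card_dicyclic_model : (4 * n <= #|<[a]> <*> <[b]>|)%N.
Proof.
have cardZ : #|{: Z * bool}| = (4 * n)%N.
  rewrite card_prod card_bool card_ord Zp_cast ?dicyclic_modulus_gt1 //.
  by rewrite mulnC mulnA.
rewrite -cardZ -cardsT.
apply: leq_trans (leq_imset_card (fun h : {perm Z * bool} => h (0, false)) _).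
apply/subset_leq_card/subsetP => -[i s] _.
have [Ga Gb] : a \in <[a]> <*> <[b]> /\ b \in <[a]> <*> <[b]>.
  by rewrite !mem_gen // inE cycle_id ?orbT.
(* [b] acts last and negates the first coordinate, hence the exponent [- i]. *)
apply/imsetP; case: s; [exists (a ^+ (- i) * b)%g | exists (a ^+ i)%g];
  rewrite ?groupM ?groupX ?permM // dic_rotX natr_Zp add0r //.
by rewrite permE /dic_flip /= opprK addr0.
Qed.

End Model.

Variables (n : nat) (gT : finGroupType) (T : {group gT}).
Hypotheses (n_gt0 : 0 < n) (dicT : dicyclic n T).

(** The relations alone bound the order of T above by 4n. By the universal property the model is a
    homomorphic image of T, which gives the reverse bound, so nothing collapses. *)
Lemma dicyclic_structure : exists x y,
  [/\ dicyclic_relations n x y, <[x]> \subset T, #[x] = (2 * n)%N,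
      T :\: <[x]> = <[x]> :* y & #|T| = (4 * n)%N].
Proof.
have [x [y [defT relxy]]] := dicyclic_homP _ _ (isoGrp_hom dicT).
have [xn xy yx] := relxy.
have xVy : x ^ y^-1 = x^-1 by rewrite conjgE invgK mulgA.
have nXY : <[y]> \subset 'N(<[x]>).
  by rewrite -cycleV norms_cycle xVy groupV cycle_id.
have sXT : <[x]> \subset T by rewrite -defT joing_subl.
have Ty : y \in T by rewrite -cycle_subG -defT joing_subr.
have sTU : T \subset <[x]> :|: <[x]> :* y.
  rewrite -defT norm_joinEr //.
  apply/subsetP=> _ /mulsgP[u _ Xu /cycleP[j ->] ->].
  have Xy2 k : y ^+ k.*2 \in <[x]>.
    by rewrite -mul2n expgM -xy !groupX ?cycle_id.
  rewrite -(odd_double_half j) addnC expgD mulgA in_setU.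
  case: odd; last by rewrite mulg1 groupM.
  by rewrite expg1 mem_rcoset mulgK (groupM Xu) ?orbT.
have leT : 4 * n <= #|T|.
  have relM := dicyclic_relations_model n_gt0.
  apply: leq_trans (card_dicyclic_model n_gt0) _.
  apply: dvdn_leq (cardG_gt0 _) (card_homg _).
  by rewrite dicT; apply/dicyclic_homP; do 2!eexists; split; last exact: relM.
have leX : #[x] <= 2 * n.
  by rewrite dvdn_leq ?order_dvdn ?xn // muln_gt0.
(* Otherwise T would lie in [<[x]>], of order at most 2n < 4n. *)
have X'y : y \notin <[x]>.
  apply: contraL leT => Xy; rewrite -ltnNge.
  apply: leq_ltn_trans (subset_leq_card sTU) _.
  rewrite rcoset_id // setUid -orderE (leq_ltn_trans leX) //.
  by rewrite ltn_pmul2r.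
have dXy : [disjoint <[x]> & <[x]> :* y].
  rewrite -setI_eq0; apply: contraR X'y => /set0Pn[z /setIP[Xz]].
  by rewrite mem_rcoset groupMl // groupV.
have defTX : T :\: <[x]> = <[x]> :* y.
  apply/eqP; rewrite eqEsubset subDset sTU subsetD disjoint_sym dXy andbT.
  by rewrite mul_subG ?sub1set.
have oT : #|T| = (2 * #[x])%N.
  rewrite -(cardsID <[x]>) (setIidPr sXT) defTX card_rcoset -orderE.
  by rewrite mul2n addnn.
have ox : #[x] = (2 * n)%N.
  apply/eqP; rewrite eqn_leq leX -(leq_pmul2l (isT : 0 < 2)).
  by rewrite -oT mulnA.
by exists x, y; rewrite oT ox mulnA.
Qed.

Lemma card_cyclic_subgroups_dicyclic :
  #|cyclic_subgroups T| = (tau (2 * n) + n)%N.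
Proof.
have [x [y [rel sXT ox defTX oT]]] := dicyclic_structure.
have := @card_cyclic_subgroups_outside _ T <[x]> 4 sXT.
rewrite {1 2}defTX card_rcoset -orderE ox (erefl : totient 4 = 2).
move=> /(_ (fun g => order_dicyclic_coset n_gt0 rel ox))/eqP.
rewrite eqn_pmul2l // => /eqP {2}->.
rewrite -{1}ox orderE -card_cyclic_subgroups_cyclic ?cycle_cyclic //.
by rewrite subnKC // subset_leq_card ?cyclic_subgroupsS.
Qed.

End Dicyclic.

Theorem theorem4p7 (n p : nat) (gT cT : finGroupType)
    (T : {group gT}) (C : {group cT})
    (n_gt0 : 0 < n) (p_prime : prime p) (p_odd : odd p) (p_ndiv : ~~ (p %| n))
    (dicT : dicyclic n T) (cycC : cyclic C) (cardC : #|C| = p) :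
  #|cyclic_subgroups (setX T C)| = tau p * (tau (2 * n) + n).
Proof.
have [_ [_ [_ _ _ _ oT]]] := dicyclic_structure n_gt0 dicT.
rewrite card_cyclic_subgroups_coprime_setX; last first.
  (* With 4 read as [2 ^ 2], it remains to exclude [p = 2], which oddness does. *)
  rewrite oT cardC coprime_sym coprimeMr !prime_coprime // p_ndiv andbT.
  rewrite (Euclid_dvdX 2 2) // andbT dvdn_prime2 //.
  by apply: contraL p_odd => /eqP->.
rewrite (card_cyclic_subgroups_dicyclic n_gt0 dicT).
by rewrite card_cyclic_subgroups_cyclic // cardC mulnC.
Qed.
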